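(* Assume: (Balanced panel of groups) $N_{g,t}>0$ for all $(g,t)\in\{1,\ldots,G\}\times\{1,\ldots,T\}$. (Sharp design) $D_{i,g,t}=D_{g,t}$ for all $(g,t)$ and $i\in\{1,\ldots,N_{g,t}\}$. (Mean independence) $\mathrm{E}[Y_{g,t}(0)\mid\mathbf{D}]=\mathrm{E}[Y_{g,t}(0)\mid\mathbf{D}_g]$ for all $(g,t)\in\{1,\ldots,G\}\times\{2,\ldots,T\}$. (Strong exogeneity) $\mathrm{E}[Y_{g,t}(0)-Y_{g,t-1}(0)\mid\mathbf{D}_g]=\mathrm{E}[Y_{g,t}(0)-Y_{g,t-1}(0)]$ for all $(g,t)\in\{1,\ldots,G\}\times\{2,\ldots,T\}$. (Parallel trends) $\mathrm{E}[Y_{g,t}(0)-Y_{g,t-1}(0)]=\mathrm{E}[Y_{k,t}(0)-Y_{k,t-1}(0)]$ for all $g,k\in\{1,\ldots,G\}$ and $t\in\{2,\ldots,T\}$. (Staggered adoption) $D_{g,t}\ge D_{g,t-1}$ for all $g$ and $t\in\{2,\ldots,T\}$. (Patterns of misclassification) For all $g$, $t\in\{1,\ldots,T\}$, $i\in\{1,\ldots,N_{g,t}\}$: $\Pr(D^*_{i,g,t}=1\mid D_{g,t}=1)=1$; and for all $g$, $t\in\{2,\ldots,T\}$, $j\in\{1,\ldots,N_{g,t-1}\}$: $\Pr(D^*_{j,g,t-1}=0\mid D_{g,t}=0,D_{g,t-1}=0)=1$. (Existence of comparison groups) For every $t\in\{2,\ldots,T\}$ and $g$ with $D_{g,t-1}=0,D_{g,t}=1$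 there is $g'\neq g$ with $D_{g',t-1}=D_{g',t}=0$. Then $$\begin{aligned}\mathrm{E}[\widehat{\mathrm{DID}}]=\ &\delta^S-\mathrm{E}\left[\frac1{N_S}\sum_{(g,t):t\ge2,D_{g,t}=1,D_{g,t-1}=0}\ \sum_{i=1}^{N_{g,t-1}}\frac{N_{g,t}}{N_{g,t-1}}D^*_{i,g,t-1}\left(Y_{i,g,t-1}(1)-Y_{i,g,t-1}(0)\right)\right]\\&-\mathrm{E}\left[\frac1{N_S}\sum_{(g,t):t\ge2,D_{g,t}=0,D_{g,t-1}=0}\ \sum_{i=1}^{N_{g,t}}\frac{N_{1,0,t}}{N_{0,0,t}}D^*_{i,g,t}\left(Y_{i,g,t}(1)-Y_{i,g,t}(0)\right)\right].\end{aligned}$$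
   Context: There are $G$ groups and $T$ periods. For each cell $(g,t)\in\{1,\ldots,G\}\times\{1,\ldots,T\}$ one observes $N_{g,t}$ units $i\in\{1,\ldots,N_{g,t}\}$. Each unit has real-valued random potential outcomes $Y_{i,g,t}(0),Y_{i,g,t}(1)$, a latent (true) binary treatment status $D^*_{i,g,t}$ and an observed binary treatment status $D_{i,g,t}$ which may differ from $D^*_{i,g,t}$. The observed outcome is $Y_{i,g,t}=D^*_{i,g,t}Y_{i,g,t}(1)+(1-D^*_{i,g,t})Y_{i,g,t}(0)$. Cell averages: $D_{g,t}=\frac1{N_{g,t}}\sum_{i=1}^{N_{g,t}}D_{i,g,t}$, and likewise $Y_{g,t}$, $Y_{g,t}(0)$. $\mathbf{D}_g=(D_{g,t})_{t\in\{1,\ldots,T\}}$, $\mathbf{D}=(D_{g,t})_{(g,t)\in\{1,\ldots,G\}\times\{1,\ldots,T\}}$. Counts: $N_S=\sum_{(g,t):t\ge2,D_{g,t}>D_{g,t-1}}N_{g,t}$; $N_{1,0,t}=\sum_{g:D_{g,t}=1,D_{g,t-1}=0}N_{g,t}$; $N_{0,0,t}=\sum_{g:D_{g,t}=0,D_{g,t-1}=0}N_{g,t}$. ATE of observed switchers: $\delta^S=\mathrm{E}\big[\frac1{N_S}\sum_{(i,g,t):t\ge2,D_{g,t}>D_{g,t-1}}(Y_{i,g,t}(1)-Y_{i,g,t}(0))\big]$. Estimator: $\widehat{\mathrm{DID}}=\frac1{N_S}\sum_{t=2}^TN_{1,0,t}\widehat{\mathrm{DID}}_t$, with $$\widehat{\mathrm{DID}}_t=\frac1{N_{1,0,t}}\sum_{g:D_{g,t}=1,D_{g,t-1}=0}N_{g,t}(Y_{g,t}-Y_{g,t-1})-\frac1{N_{0,0,t}}\sum_{g:D_{g,t}=0,D_{g,t-1}=0}N_{g,t}(Y_{g,t}-Y_{g,t-1}),$$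 set to zero when there is no group with $D_{g,t}=1,D_{g,t-1}=0$ or no group with $D_{g,t}=D_{g,t-1}=0$.
   Formalization: Mean independence E[Y_{g,t}(0)|D]=E[Y_{g,t}(0)|D_g] is assumed also at t=1 (when T≥2), since with t≥2 only the claim is false; potential outcomes are taken integrable, and 1/N_S is read as 0 when N_S=0. *)

(* Defs.v *)
From HB Require Import structures.
From mathcomp Require Import all_boot all_order all_algebra.
From mathcomp Require Import all_classical all_reals all_analysis.

Set Implicit Arguments.
Unset Strict Implicit.
Unset Printing Implicit Defensive.

Import Order.TTheory GRing.Theory Num.Theory.
Import numFieldNormedType.Exports.

Local Open Scope classical_set_scope.
Local Open Scope ring_scope.

Section Conditioning.
Context d (Omega : measurableType d) (R : realType) (P : probability Omega R).

(* The sigma-algebra generated by the real random variables X j, j in I. *)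
Definition sigma_gen (J : Type) (I : set J) (X : J -> Omega -> R) :
    set (set Omega) :=
  <<s \bigcup_(j in I) preimage_set_system setT (X j) measurable >>.

(* Z is a version of E[X | F] (Kolmogorov's definition). *)
Definition cond_expectation (F : set (set Omega)) (X Z : Omega -> R) : Prop :=
  [/\ forall B : set R, measurable B -> F (Z @^-1` B),
      P.-integrable setT (EFin \o Z) &
      forall A, F A -> (\int[P]_(w in A) (Z w)%:E = \int[P]_(w in A) (X w)%:E)%E].

(* E[X | F1] = E[X | F2] almost surely; versions being a.s. unique, the choice
   of Z1 and Z2 is irrelevant. *)
Definition cond_expectation_eq (F1 F2 : set (set Omega)) (X : Omega -> R) :
    Prop :=
  exists Z1 Z2 : Omega -> R,
    [/\ cond_expectation F1 X Z1, cond_expectation F2 X Z2 &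
        {ae P, forall w, Z1 w = Z2 w}].

(* E[X | F] = E[X] almost surely. *)
Definition mean_indep (F : set (set Omega)) (X : Omega -> R) : Prop :=
  exists2 Z : Omega -> R, cond_expectation F X Z &
    {ae P, forall w, ((Z w)%:E = 'E_P[X])%E}.

(* Pr(A | B) = 1; this imposes nothing when Pr(B) = 0, where the conditional
   probability is undefined. *)
Definition cond_prob_eq1 (A B : set Omega) : Prop :=
  P B != 0%E -> fine (P (A `&` B)) / fine (P B) = 1.

End Conditioning.

(* Groups are indexed by 'I_G and periods by the natural numbers 1, ..., T:
   nothing below uses the data outside that range. Cell sizes are not random. *)
Record panel d (Omega : measurableType d) (R : realType)
    (P : probability Omega R) (G : nat) := Panel {
  cell_size : 'I_G -> nat -> nat;
  pot0 : forall g t, 'I_(cell_size g t) -> {RV P >-> R};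
  pot1 : forall g t, 'I_(cell_size g t) -> {RV P >-> R};
  true_treat : forall g t, 'I_(cell_size g t) -> {RV P >-> bool};
  obs_treat : forall g t, 'I_(cell_size g t) -> {RV P >-> bool}
}.

Section Panel.
Context d (Omega : measurableType d) (R : realType) (P : probability Omega R).
Context (G : nat) (p : panel P G).

Implicit Types (g : 'I_G) (t T : nat) (w : Omega).

Local Notation N := (cell_size p).

Definition outcome g t (i : 'I_(N g t)) w : R :=
  (true_treat i w)%:R * pot1 i w + (1 - (true_treat i w)%:R) * pot0 i w.

Definition unit_effect g t (i : 'I_(N g t)) w : R := pot1 i w - pot0 i w.

Definition cell_mean n (X : 'I_n -> Omega -> R) w : R :=
  n%:R^-1 * \sum_(i < n) X i w.

Definition Dbar g t : Omega -> R :=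
  cell_mean (fun (i : 'I_(N g t)) w => (obs_treat i w)%:R).

Definition Ybar g t : Omega -> R := cell_mean (@outcome g t).

Definition Y0bar g t : Omega -> R :=
  cell_mean (fun (i : 'I_(N g t)) w => pot0 i w).

Definition Y0trend g t : Omega -> R := fun w => Y0bar g t w - Y0bar g t.-1 w.

(* The sigma-algebras of D_g = (D_{g,t})_t and of D = (D_{g,t})_{g,t}. *)
Definition sigma_Dg T g : set (set Omega) :=
  sigma_gen [set t | (1 <= t <= T)%N] (Dbar g).

Definition sigma_D T : set (set Omega) :=
  sigma_gen [set c : 'I_G * nat | (1 <= c.2 <= T)%N] (fun c => Dbar c.1 c.2).

Definition increases g t w : bool := Dbar g t.-1 w < Dbar g t w.
Definition joins g t w : bool := (Dbar g t w == 1) && (Dbar g t.-1 w == 0).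
Definition stays0 g t w : bool := (Dbar g t w == 0) && (Dbar g t.-1 w == 0).

(* The counts are cast to R; 0^-1 = 0, so that all the averages over the
   observed switchers are 0 on the event N_S = 0. *)
Definition N_S T w : R :=
  \sum_(2 <= t < T.+1) \sum_(g | increases g t w) (N g t)%:R.

Definition N10 t w : R := \sum_(g | joins g t w) (N g t)%:R.

Definition N00 t w : R := \sum_(g | stays0 g t w) (N g t)%:R.

Definition DID_t t w : R :=
  if [exists g, joins g t w] && [exists g, stays0 g t w] then
    (N10 t w)^-1 *
      (\sum_(g | joins g t w) (N g t)%:R * (Ybar g t w - Ybar g t.-1 w))
    - (N00 t w)^-1 *
      (\sum_(g | stays0 g t w) (N g t)%:R * (Ybar g t w - Ybar g t.-1 w))
  else 0.

Definition DID T w : R :=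
  (N_S T w)^-1 * \sum_(2 <= t < T.+1) N10 t w * DID_t t w.

Definition delta_S T : \bar R :=
  ('E_P[(fun w => (N_S T w)^-1 *
    \sum_(2 <= t < T.+1) \sum_(g | increases g t w)
      \sum_(i < N g t) unit_effect i w)%R])%E.

End Panel.

(* Main.v *)
(* With N_{1,0,t} / N_{0,0,t} = r_t, misclassification on the joining and staying
   groups gives almost surely DID = (average effect of the switchers) - (the two
   bias terms) + sum_{g,t} W_{g,t} (trend of Y_{g,t}(0)), where
   W_{g,t} = N_S^-1 N_{g,t} (1[g joins at t] - r_t 1[g stays untreated at t])
   is sigma(D)-measurable, takes finitely many values, and has sum_g W_{g,t} = 0.
   So the trends may be centered at their common mean. By mean independence and
   strong exogeneity the centered trends have conditional mean 0 given D: they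
   integrate to 0 on every set of sigma(D), hence against every W_{g,t}. *)
Require Import Defs.
From HB Require Import structures.
From mathcomp Require Import all_boot all_order all_algebra.
From mathcomp Require Import all_classical all_reals all_analysis.
From mathcomp Require Import measurable_realfun ring.

Set Implicit Arguments.
Unset Strict Implicit.
Unset Printing Implicit Defensive.

Import Order.TTheory GRing.Theory Num.Theory.
Import numFieldNormedType.Exports.

Local Open Scope classical_set_scope.
Local Open Scope ring_scope.

(** A first difference at [t >= 2] involves the periods [t] and [t.-1]; both fall in the range 1 to
    [T] covered by the assumptions and by the generators of [sigma_D]. *)
Lemma leq_pred2 t T : (2 <= t <= T)%N -> (1 <= t <= T)%N /\ (1 <= t.-1 <= T)%N.
Proof. by case: t => [|[|t]]//= tT; rewrite tT ltnW. Qed.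

(** * Random variables with finitely many values *)

Section Finitary.
Context {d} {Omega : measurableType d} {R : realType} (P : probability Omega R).
Implicit Types (X Y : Omega -> R) (F : set (set Omega)).

Local Notation integrable X := (P.-integrable setT (EFin \o X)).

Lemma integrable_addr X Y :
  integrable X -> integrable Y -> integrable (fun w => X w + Y w).
Proof. by move=> iX iY; have := integrableD measurableT iX iY; apply: eq_integrable. Qed.

Lemma integrable_subr X Y :
  integrable X -> integrable Y -> integrable (fun w => X w - Y w).
Proof. by move=> iX iY; have := integrableB measurableT iX iY; apply: eq_integrable. Qed.

Lemma integrable_mulrl (c : R) X : integrable X -> integrable (fun w => c * X w).
Proof. by move=> iX; have := integrableZl measurableT c iX; apply: eq_integrable. Qed.

Lemma integrable_sumr (I : eqType) (r : seq I) (Q : pred I) (X : I -> Omega -> R) :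
  (forall i, i \in r -> Q i -> integrable (X i)) ->
  integrable (fun w => \sum_(i <- r | Q i) X i w).
Proof.
move=> iX; rewrite (_ : _ \o _ =
  (fun w => \sum_(i <- r | (i \in r) && Q i) (X i w)%:E)%E); last first.
  by apply/funext => w; rewrite /= -sumEFin [LHS]big_seq_cond.
by apply: integrable_sum => // i /andP[ir Qi]; exact: iX.
Qed.

Lemma integrable_restrict A X :
  measurable A -> integrable X -> P.-integrable setT ((EFin \o X) \_ A).
Proof.
move=> mA iX; apply: (integrable_mkcond _ mA).1.
exact: (integrableS measurableT).
Qed.

(** Factoring through a finite type with fibres in [F] puts no measurable structure on [U], so the
    notion passes through any operation, division included, and allows function values. [F] is
    [measurable] for integrability and [sigma_D] for the orthogonality argument. *)
Definition finitary F (U : Type) (f : Omega -> U) :=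
  exists (S : finType) (V : Omega -> S) (h : S -> U),
    (forall s, F (V @^-1` [set s])) /\ f = h \o V.

Lemma finitary_comp F (U U' : Type) (k : U -> U') f :
  finitary F f -> finitary F (fun w => k (f w)).
Proof. by move=> [S [V [h [FV ->]]]]; exists S, V, (k \o h). Qed.

Lemma sub_finitary F F' (U : Type) (f : Omega -> U) :
  F `<=` F' -> finitary F f -> finitary F' f.
Proof. by move=> FF' [S [V [h [FV ->]]]]; exists S, V, h; split=> // s; exact/FF'. Qed.

(** Only the fibre through [w] contributes, so the product is a finite linear combination of
    restrictions of [X] to fibres; integrability and integrals are then read off term by term. *)
Lemma finitary_mul_decomp (S : finType) (V : Omega -> S) (h : S -> R) X w :
  (h (V w) * X w)%:E =
  (\sum_s (h s)%:E * (((EFin \o X) \_ (V @^-1` [set s])) w))%E.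
Proof.
rewrite (bigD1 (V w))//= patchE mem_set// big1 ?adde0//= => s sVw.
by rewrite patchE memNset ?mule0// => /= Vws; rewrite Vws eqxx in sVw.
Qed.

Lemma integrable_finitary_mul f X :
  finitary measurable f -> integrable X -> integrable (fun w => f w * X w).
Proof.
move=> [S [V [h [mV ->]]]] iX.
rewrite (_ : _ \o _ = fun w =>
  (\sum_s (h s)%:E * (((EFin \o X) \_ (V @^-1` [set s])) w))%E); last first.
  by apply/funext => w; exact: finitary_mul_decomp.
apply: integrable_sum => // s _; apply: integrableZl => //.
exact: integrable_restrict.
Qed.

Lemma integrable_finitary_sum (I : eqType) (r : seq I) (Q : I -> Omega -> bool)
    (X : I -> Omega -> R) :
  (forall i, i \in r -> finitary measurable (Q i)) ->
  (forall i, i \in r -> integrable (X i)) ->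
  integrable (fun w => \sum_(i <- r | Q i w) X i w).
Proof.
move=> mQ iX; rewrite (_ : (fun w => _) =
    fun w => \sum_(i <- r) (Q i w)%:R * X i w); last first.
  apply/funext => w; rewrite big_mkcond/=; apply: eq_bigr => i _.
  by case: (Q i w); rewrite ?mul1r ?mul0r.
apply: integrable_sumr => i ir _; apply: integrable_finitary_mul; last exact: iX.
exact: (finitary_comp (fun b : bool => b%:R)) (mQ i ir).
Qed.

Lemma integral_sumr_eq0 (I : eqType) (r : seq I) (X : I -> Omega -> R) :
  (forall i, i \in r -> integrable (X i)) ->
  (forall i, i \in r -> \int[P]_w (X i w)%:E = 0)%E ->
  (\int[P]_w (\sum_(i <- r) X i w)%:E = 0)%E.
Proof.
(* Summands with index outside [r] are replaced by 0, because [integral_sum] asks for integrability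
   at every index. *)
move=> iX X0; rewrite (eq_integral
    (fun w => \sum_(i <- r) (if i \in r then (X i w)%:E else 0%E))%E); last first.
  by move=> w _; rewrite -big_mkcond/= sumEFin -big_seq.
rewrite integral_sum// => [|i]; last first.
  by case: (boolP (i \in r)) => [/iX//|_]; exact: integrable0.
by rewrite big1// => i _; case: (boolP (i \in r)) => [/X0//|_]; rewrite integral0.
Qed.

(** The fibres of [f] lie in [F], so [X] has zero integral on each of them, and the integral of
    [f * X] is a finite combination of these zeros. *)
Lemma integral_finitary_mul_eq0 F f X :
  F `<=` measurable -> finitary F f -> integrable X ->
  (forall A, F A -> \int[P]_(w in A) (X w)%:E = 0)%E ->
  (\int[P]_w (f w * X w)%:E = 0)%E.
Proof.
move=> Fm [S [V [h [FV ->]]]] iX X0.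
rewrite (eq_integral _ _ (fun w _ => finitary_mul_decomp V h X w)).
have iXs s : P.-integrable setT ((EFin \o X) \_ (V @^-1` [set s])).
  exact/integrable_restrict/iX/Fm/FV.
rewrite integral_sum// => [|s]; last exact: integrableZl.
by rewrite big1// => s _; rewrite integralZl// -integral_mkcond X0// mule0.
Qed.

Context (F : set (set Omega)).
Context (F_sigma : sigma_algebra setT F).

Lemma sigma_algebra_setI A B : F A -> F B -> F (A `&` B).
Proof.
case: F_sigma => F0 FC FU FA FB.
rewrite -[A `&` B]setCK setCI -[~` (_ `|` _)]setTD -bigcup2E; apply/FC/FU.
by move=> [|[|n]]//=; rewrite -setTD; exact: FC.
Qed.

Lemma finitary_cst (U : Type) (u : U) : finitary F (fun=> u).
Proof.
case: F_sigma => F0 FC FU.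
exists unit, (fun=> tt), (fun=> u); split=> // s.
rewrite (_ : _ @^-1` _ = setT); first by rewrite -[setT]setD0; exact: FC.
by apply/seteqP; split=> // w _; case: s.
Qed.

(** The pair of finite codes is again a finite code, and its fibres are intersections of fibres. *)
Lemma finitary_comp2 (U1 U2 U3 : Type) (k : U1 -> U2 -> U3) f g :
  finitary F f -> finitary F g -> finitary F (fun w => k (f w) (g w)).
Proof.
move=> [S [V [h [FV ->]]]] [S' [V' [h' [FV' ->]]]].
exists (S * S')%type, (fun w => (V w, V' w)), (fun s => k (h s.1) (h' s.2)).
split=> // -[s s']; rewrite (_ : _ @^-1` _ = V @^-1` [set s] `&` V' @^-1` [set s']).
  exact: sigma_algebra_setI.
by apply/seteqP; split=> w /= => [[-> ->]//|[-> ->]].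
Qed.

Lemma finitary_big (U : Type) (op : U -> U -> U) (x0 : U) (I : eqType) (r : seq I)
    (Q : I -> Omega -> bool) (f : I -> Omega -> U) :
  (forall i, i \in r -> finitary F (Q i)) ->
  (forall i, i \in r -> finitary F (f i)) ->
  finitary F (fun w => \big[op/x0]_(i <- r | Q i w) f i w).
Proof.
elim: r => [|i r IH] FQ Ff.
  by under eq_fun do rewrite big_nil; exact: finitary_cst.
under eq_fun do rewrite big_cons.
have Fr : finitary F (fun w => \big[op/x0]_(i <- r | Q i w) f i w).
  by apply: IH => j jr; [apply: FQ|apply: Ff]; rewrite inE jr orbT.
(* The head of the list is seen as a function [U -> U] acting on the value of the tail; applying it
   is one more binary operation. *)
have Fi : finitary F (fun w u => if Q i w then op (f i w) u else u).
  by apply: (finitary_comp2 (fun (b : bool) x u => if b then op x u else u));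
    [apply: FQ|apply: Ff]; rewrite mem_head.
exact: (finitary_comp2 (fun g u => g u) Fi Fr).
Qed.

Lemma finitary_bool (b : Omega -> bool) :
  F (b @^-1` [set true]) -> F (b @^-1` [set false]) -> finitary F b.
Proof. by move=> Ft Ff; exists bool, b, id; split=> // -[]. Qed.

End Finitary.

(** * Conditional expectations and centered variables *)

Section ConditionalExpectation.
Context {d} {Omega : measurableType d} {R : realType} (P : probability Omega R).
Implicit Types (X Y Z : Omega -> R) (G : set (set Omega)).

Local Notation integrable X := (P.-integrable setT (EFin \o X)).

(** Changing the type of the domain makes the closure properties of measurable functions available
    for a sub-sigma-algebra. *)
Lemma measurable_g_sigma_preimage G X :
  (forall B : set R, measurable B -> <<s G >> (X @^-1` B)) ->
  measurable_fun setT (X : g_sigma_algebraType G -> R).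
Proof. by move=> mX _ B mB; rewrite setTI; exact: mX. Qed.

Lemma integral_subr A X Y : measurable A -> integrable X -> integrable Y ->
  (\int[P]_(w in A) (X w - Y w)%:E =
   \int[P]_(w in A) (X w)%:E - \int[P]_(w in A) (Y w)%:E)%E.
Proof.
move=> mA iX iY; rewrite -integralB_EFin//; exact: (integrableS measurableT).
Qed.

(** The events [X > 0] and [X < 0] belong to the sigma-algebra, so [X] has zero integral on each;
    having constant sign there, it vanishes almost surely on both. *)
Lemma ae_eq0_sub_sigma_algebra G X :
  <<s G >> `<=` measurable ->
  (forall B : set R, measurable B -> <<s G >> (X @^-1` B)) ->
  integrable X ->
  (forall A, <<s G >> A -> \int[P]_(w in A) (X w)%:E = 0)%E ->
  {ae P, forall w, X w = 0}.
Proof.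
move=> Gm mX iX X0.
have key (Y : Omega -> R) A : <<s G >> A -> integrable Y ->
    (forall w, A w -> 0 <= Y w) -> (\int[P]_(w in A) (Y w)%:E = 0)%E ->
    {ae P, forall w, A w -> Y w = 0}.
  move=> GA iY Y0 intY; have mA : measurable A by exact: Gm.
  have /measurable_int mY : P.-integrable A (EFin \o Y).
    exact: (integrableS measurableT).
  have /(ae_eq_integral_abs P mA mY) : (\int[P]_(w in A) `|(EFin \o Y) w| = 0)%E.
    rewrite -[RHS]intY; apply: eq_integral => w; rewrite inE => Aw /=.
    by rewrite ger0_norm// Y0.
  by apply: filterS => w /[apply] -[].
have pos : {ae P, forall w, 0 < X w -> X w = 0}.
  have GA : <<s G >> (X @^-1` `]0, +oo[) by exact: mX.
  apply: filterS (key X _ GA iX _ (X0 _ GA)) => w /=; rewrite in_itv/= andbT //.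
  exact: ltW.
have neg : {ae P, forall w, X w < 0 -> X w = 0}.
  have GA : <<s G >> (X @^-1` `]-oo, 0[) by exact: mX.
  have mA := Gm _ GA.
  have iN : integrable (fun w => - X w).
    by have := integrableN iX; apply: eq_integrable.
  have intN : (\int[P]_(w in X @^-1` `]-oo, 0%R[) (- X w)%:E = 0)%E.
    under eq_integral do rewrite EFinN.
    rewrite integralN ?X0 ?oppe0//.
    by apply: integrable_add_def => //; exact: (integrableS measurableT).
  apply: filterS (key _ _ GA iN _ intN) => w /=; rewrite in_itv/=.
    by move=> /[apply] /eqP; rewrite oppr_eq0 => /eqP.
  by rewrite oppr_ge0 => /ltW.
by apply: filterS2 pos neg => w; case: (ltgtP (X w) 0); auto.
Qed.

(* E[X - X' | G1] = E[X - X' | G2] = E[X - X']; the first equality needs the two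
   sigma-algebras to agree on X and on X' separately. *)
Lemma integral_centered_eq0 G1 G2 X X' :
  <<s G1 >> `<=` measurable -> <<s G2 >> `<=` measurable ->
  integrable X -> integrable X' ->
  cond_expectation_eq P <<s G1 >> <<s G2 >> X ->
  cond_expectation_eq P <<s G1 >> <<s G2 >> X' ->
  mean_indep P <<s G2 >> (fun w => X w - X' w) ->
  forall A, <<s G1 >> A ->
  (\int[P]_(w in A)
     (X w - X' w - fine 'E_P[(fun w => X w - X' w)%R])%:E = 0)%E.
Proof.
move=> G1m G2m iX iX' [Z1 [Z2 [[_ iZ1 Z1X] [mZ2 iZ2 Z2X] Z12]]].
move=> [Z1' [Z2' [[_ iZ1' Z1X'] [mZ2' iZ2' Z2X'] Z12']]] [Z [mZ iZ ZX] Zcst].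
set mu := fine _ => A GA.
have icst : integrable (cst mu).
  exact: finite_measure_integrable_cst.
have iXX' := integrable_subr iX iX'.
have Zmu : {ae P, forall w, Z w = mu}.
  by apply: filterS Zcst => w Zw; rewrite /mu -Zw.
(* [Z2 - Z2'] and [Z] are both versions of the conditional expectation of [X - X'] given [G2], and
   [Z] is almost surely [mu]. So this difference is measurable for [G2] and has zero integral on all
   its events. *)
have U0 : {ae P, forall w, Z2 w - Z2' w - mu = 0}.
  apply: (ae_eq0_sub_sigma_algebra (G := G2)) => //.
  - have mZ2G := measurable_g_sigma_preimage mZ2.
    have mZ2G' := measurable_g_sigma_preimage mZ2'.
    have mU := measurable_funB (measurable_funB mZ2G mZ2G') (measurable_cst mu).
    by move=> B mB; have := mU measurableT B mB; rewrite setTI.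
  - exact/integrable_subr/icst/integrable_subr.
  - move=> B GB; have mB := G2m _ GB.
    rewrite integral_subr//; last exact: integrable_subr.
    rewrite integral_subr// Z2X// Z2X'// -integral_subr// -ZX//.
    rewrite (_ : \int[P]_(w in B) (Z w)%:E = \int[P]_(w in B) mu%:E)%E ?subee//.
      by apply: integrable_fin_num => //; exact: (integrableS measurableT).
    apply: ae_eq_integral => //.
      by apply: measurable_funTS; exact: measurable_int iZ.
    by apply: filterS Zmu => w -> _.
have mA := G1m _ GA.
(* [A] is an event of the first sigma-algebra, so [X] and [X'] may be replaced on it by [Z1] and
   [Z1'], which almost surely equal [Z2] and [Z2']. *)
rewrite integral_subr// integral_subr// -Z1X// -Z1X'// -!integral_subr//; last first.
  exact: integrable_subr.
rewrite -[RHS](integral0 P A).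
have iU : integrable (fun w => Z1 w - Z1' w - mu).
  exact/integrable_subr/icst/integrable_subr.
apply: ae_eq_integral => //.
  by apply: measurable_funTS; exact: measurable_int iU.
by apply: filterS3 Z12 Z12' U0 => w -> -> -> _.
Qed.

End ConditionalExpectation.

(** * Measurability of the treatment patterns and of the counts *)

Section PanelMeasurability.
Context {d} {Omega : measurableType d} {R : realType} (P : probability Omega R).
Context {G : nat} (p : panel P G) (T : nat).

Local Notation N := (cell_size p).

(** The exceptional set is the part of [B] outside [A]: it is null because [B] is, or because the
    quotient 1 forces [A] and [B] to meet in the full mass of [B]. *)
Lemma cond_prob_eq1_ae (A B : set Omega) : measurable A -> measurable B ->
  cond_prob_eq1 P A B -> {ae P, forall w, B w -> A w}.
Proof.
move=> mA mB AB; exists (B `\` A); split.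
- exact: measurableD.
- have [PB0|/AB PAB] := eqVneq (P B) 0%E.
    by apply/(subset_measure0 _ _ _ PB0) => //; exact: measurableD.
  have fB : P B \is a fin_num by exact: fin_num_measure.
  have fAB : P (A `&` B) \is a fin_num.
    by apply: fin_num_measure; exact: measurableI.
  have PABB : P (B `&` A) = P B.
    rewrite setIC -(fineK fB) -(fineK fAB); congr EFin.
    exact: divr1_eq.
  rewrite [LHS]measureD//; last by rewrite -ge0_fin_numE.
  by rewrite [X in (_ - X)%E]PABB subee.
- by move=> w /= /not_implyP.
Qed.

Lemma finitary_true_treat g t (i : 'I_(N g t)) :
  finitary measurable (fun w => (true_treat i w)%:R : R).
Proof.
apply: (finitary_comp (fun b : bool => b%:R)).
apply: finitary_bool; rewrite -[_ @^-1` _]setTI;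
  exact: (measurable_funP (true_treat i)).
Qed.

Lemma measurable_Dbar g t : measurable_fun setT (Dbar p g t).
Proof.
apply: measurable_funM => //; apply: measurable_sum => i.
have mR : measurable_fun setT (fun b : bool => b%:R : R) by [].
exact: (measurableT_comp mR (measurable_funP (obs_treat i))).
Qed.

Lemma sub_sigma_gen_measurable (J : Type) (I : set J) (X : J -> Omega -> R) :
  (forall j, measurable_fun setT (X j)) -> sigma_gen I X `<=` measurable.
Proof.
move=> mX; apply: smallest_sub; first exact: sigma_algebra_measurable.
by move=> A [j _ [B mB <-]]; exact: mX.
Qed.

Lemma measurable_fun_sigma_gen (J : Type) (I : set J) (X : J -> Omega -> R) j :
  I j -> measurable_fun setT (X j : g_sigma_algebraType
    (\bigcup_(j in I) preimage_set_system setT (X j) measurable) -> R).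
Proof.
move=> Ij; apply: measurable_g_sigma_preimage => B mB.
apply: sub_sigma_algebra; exists j => //; exists B => //.
by rewrite setTI.
Qed.

Lemma finitary_measurable_bool (C : set (set Omega))
    (b : g_sigma_algebraType C -> bool) :
  measurable_fun setT b -> finitary <<s C >> b.
Proof.
by move=> mb; apply: finitary_bool; rewrite -[_ @^-1` _]setTI; exact: mb.
Qed.

Local Notation FD := (sigma_D p T).

Lemma sigma_D_sigma_algebra : sigma_algebra setT FD.
Proof. exact: smallest_sigma_algebra. Qed.

Lemma sub_sigma_D_measurable : FD `<=` measurable.
Proof. by apply: sub_sigma_gen_measurable => c; exact: measurable_Dbar. Qed.

Lemma sub_sigma_Dg_measurable g : sigma_Dg p T g `<=` measurable.
Proof. by apply: sub_sigma_gen_measurable => t; exact: measurable_Dbar. Qed.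

Section Events.
Context (g : 'I_G) (t : nat) (tT : (2 <= t <= T)%N).

Let mDt := @measurable_fun_sigma_gen _
  [set c : 'I_G * nat | (1 <= c.2 <= T)%N] (fun c => Dbar p c.1 c.2) (g, t).
Let mDt1 := @measurable_fun_sigma_gen _
  [set c : 'I_G * nat | (1 <= c.2 <= T)%N] (fun c => Dbar p c.1 c.2) (g, t.-1).

Let t1 : (1 <= t <= T)%N := (leq_pred2 tT).1.
Let t1' : (1 <= t.-1 <= T)%N := (leq_pred2 tT).2.

Lemma finitary_increases : finitary FD (increases p g t).
Proof.
apply: finitary_measurable_bool.
exact: measurable_fun_ltr (mDt1 t1') (mDt t1).
Qed.

Lemma finitary_joins : finitary FD (joins p g t).
Proof.
apply: finitary_measurable_bool.
exact: (measurable_and (measurable_fun_eqr (mDt t1) (measurable_cst (1 : R)))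
  (measurable_fun_eqr (mDt1 t1') (measurable_cst (0 : R)))).
Qed.

Lemma finitary_stays0 : finitary FD (stays0 p g t).
Proof.
apply: finitary_measurable_bool.
exact: (measurable_and (measurable_fun_eqr (mDt t1) (measurable_cst (0 : R)))
  (measurable_fun_eqr (mDt1 t1') (measurable_cst (0 : R)))).
Qed.

End Events.

Lemma finitary_N_S : finitary FD (N_S p T).
Proof.
apply: (finitary_big sigma_D_sigma_algebra) => t tT.
  exact: (finitary_cst sigma_D_sigma_algebra).
apply: (finitary_big sigma_D_sigma_algebra) => g _.
  by apply: finitary_increases; rewrite mem_index_iota in tT.
exact: (finitary_cst sigma_D_sigma_algebra).
Qed.

Lemma finitary_N10 t : (2 <= t <= T)%N -> finitary FD (N10 p t).
Proof.
move=> tT; apply: (finitary_big sigma_D_sigma_algebra) => g _.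
  exact: finitary_joins.
exact: (finitary_cst sigma_D_sigma_algebra).
Qed.

Lemma finitary_N00 t : (2 <= t <= T)%N -> finitary FD (N00 p t).
Proof.
move=> tT; apply: (finitary_big sigma_D_sigma_algebra) => g _.
  exact: finitary_stays0.
exact: (finitary_cst sigma_D_sigma_algebra).
Qed.

Lemma finitary_ratio t : (2 <= t <= T)%N ->
  finitary FD (fun w => N10 p t w / N00 p t w).
Proof.
move=> tT; apply: (finitary_comp2 sigma_D_sigma_algebra (fun x y => x / y)).
  exact: finitary_N10.
exact: finitary_N00.
Qed.

End PanelMeasurability.

(** * Algebraic decomposition of the estimator *)

Section Decomposition.
Context {d} {Omega : measurableType d} {R : realType} (P : probability Omega R).
Context {G : nat} (p : panel P G) (T : nat).

Local Notation N := (cell_size p).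

(** For each unit, Y = Y(0) + D* (Y(1) - Y(0)). *)
Lemma Ybar_decomp g t w :
  Ybar p g t w = Y0bar p g t w
    + (N g t)%:R^-1 * \sum_(i < N g t) (true_treat i w)%:R * unit_effect i w.
Proof.
rewrite /Ybar /Y0bar /cell_mean -mulrDr -big_split/=; congr (_ * _).
by apply: eq_bigr => i _; rewrite /outcome /unit_effect; ring.
Qed.

(** The weight [N g t] cancels the averaging at [t] but not the one at [t.-1]; this leaves the ratio
    of cell sizes seen in the first bias term. *)
Lemma Ytrend_decomp g t w : (0 < N g t)%N ->
  (N g t)%:R * (Ybar p g t w - Ybar p g t.-1 w) =
  (N g t)%:R * Y0trend p g t w
  + (\sum_(i < N g t) (true_treat i w)%:R * unit_effect i w
     - \sum_(i < N g t.-1) (N g t)%:R / (N g t.-1)%:R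
         * (true_treat i w)%:R * unit_effect i w).
Proof.
move=> N0; have {}N0 : (N g t)%:R != 0 :> R by rewrite pnatr_eq0 -lt0n.
under [X in _ + (_ - X)]eq_bigr do rewrite -mulrA.
rewrite !Ybar_decomp -[X in _ = _ + (_ - X)]mulr_sumr /Y0trend.
set x := (\sum_(i < N g t) _); set y := (\sum_(i < N g t.-1) _).
rewrite [LHS](_ : _ = (N g t)%:R * (Y0bar p g t w - Y0bar p g t.-1 w)
  + ((N g t)%:R * (N g t)%:R^-1 * x - (N g t)%:R / (N g t.-1)%:R * y)); last by ring.
by rewrite divff// mul1r.
Qed.

(** Indicators replace the random index sets, so that joining and staying groups share one sum over
    all [g], with all dependence on the observed treatments in the weight. *)
Definition DID_weight g t w : R :=
  (N_S p T w)^-1 * ((N g t)%:R *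
    ((joins p g t w)%:R - N10 p t w / N00 p t w * (stays0 p g t w)%:R)).

(** * Identities at a sample point where the almost sure assumptions hold *)

Section Pointwise.
Context (w : Omega).
Context (size_gt0 : forall g t, (1 <= t <= T)%N -> (0 < N g t)%N).
Context (D01 : forall g t, (1 <= t <= T)%N -> Dbar p g t w = 0 \/ Dbar p g t w = 1).
Context (treated : forall g t (i : 'I_(N g t)), (1 <= t <= T)%N ->
  Dbar p g t w = 1 -> true_treat i w = true).
Context (untreated : forall g t (i : 'I_(N g t.-1)), (2 <= t <= T)%N ->
  Dbar p g t w = 0 /\ Dbar p g t.-1 w = 0 -> true_treat i w = false).
Context (comparison : forall g t, (2 <= t <= T)%N ->
  Dbar p g t.-1 w = 0 -> Dbar p g t w = 1 ->
  exists g', [/\ g' != g, Dbar p g' t.-1 w = 0 & Dbar p g' t w = 0]).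

Section Period.
Context (t : nat) (tT : (2 <= t <= T)%N).

Let t1 : (1 <= t <= T)%N := (leq_pred2 tT).1.
Let t1' : (1 <= t.-1 <= T)%N := (leq_pred2 tT).2.

(** Cell treatments are 0 or 1, so an increase can only go from 0 to 1. This identifies the
    switchers of [delta_S] with the joining groups of the estimator. *)
Lemma increases_joins g : increases p g t w = joins p g t w.
Proof.
rewrite /increases /joins.
by have [->|->] := D01 g t1; have [->|->] := D01 g t1';
  rewrite ?ltxx ?ltr01 ?ltr10 ?eqxx ?oner_eq0 // eq_sym oner_eq0.
Qed.

Lemma exists_stays0 g : joins p g t w -> exists g', stays0 p g' t w.
Proof.
move=> /andP[/eqP D1 /eqP D0]; have [g' [_ D0' D1']] := comparison tT D0 D1.
by exists g'; rewrite /stays0 D0' D1' eqxx.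
Qed.

Lemma sum_size_gt0 (Q : pred 'I_G) g : Q g -> 0 < \sum_(g | Q g) (N g t)%:R :> R.
Proof.
by move=> Qg; rewrite (bigD1 g)//= ltr_pwDl ?sumr_ge0 ?ltr0n ?size_gt0.
Qed.

Lemma N10_no_joins : [exists g, joins p g t w] = false -> N10 p t w = 0.
Proof.
by move=> noJ; rewrite /N10 big_pred0// => g; apply: contraFF noJ => ?; apply/existsP; exists g.
Qed.

(** If a group joins, its comparison group makes [N00] positive and the division cancels; if none
    joins, both sides are 0, whatever the value of [N00]. *)
Lemma N10_ratio : N10 p t w / N00 p t w * N00 p t w = N10 p t w.
Proof.
have [/existsP[g Jg]|noJ] := boolP [exists g, joins p g t w].
  have [g' Sg'] := exists_stays0 Jg.
  by rewrite divfK// gt_eqF//; exact: sum_size_gt0 Sg'.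
by rewrite N10_no_joins ?mul0r//; exact: negbTE.
Qed.

(** The default branch of [DID_t] disappears: a joining group brings a comparison group, so the test
    succeeds, and without joining groups [N10 = 0] annihilates both sides. *)
Lemma N10_DID_t : N10 p t w * DID_t p t w =
  \sum_(g | joins p g t w) (N g t)%:R * (Ybar p g t w - Ybar p g t.-1 w)
  - N10 p t w / N00 p t w *
    \sum_(g | stays0 p g t w) (N g t)%:R * (Ybar p g t w - Ybar p g t.-1 w).
Proof.
rewrite /DID_t.
have [/existsP[g Jg]|noJ] := boolP [exists g, joins p g t w].
  have [g' Sg'] := exists_stays0 Jg.
  have -> : [exists g, stays0 p g t w] by apply/existsP; exists g'.
  have N0 : N10 p t w != 0 by rewrite gt_eqF//; exact: sum_size_gt0 Jg.
  by rewrite /= mulrBr !mulrA divff// mul1r.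
rewrite N10_no_joins ?(negbTE noJ)// mulr0 !mul0r subr0 big_pred0// => g.
by apply: contraNF noJ => ?; apply/existsP; exists g.
Qed.

(** All units of a joining group are truly treated at [t], which yields the full effect; those
    already truly treated at [t.-1] yield the first bias term. *)
Lemma joiner_trend g : joins p g t w ->
  (N g t)%:R * (Ybar p g t w - Ybar p g t.-1 w) =
  (N g t)%:R * Y0trend p g t w + (\sum_(i < N g t) unit_effect i w
   - \sum_(i < N g t.-1) (N g t)%:R / (N g t.-1)%:R
         * (true_treat i w)%:R * unit_effect i w).
Proof.
move=> /andP[/eqP D1 _]; rewrite Ytrend_decomp ?size_gt0//.
by under eq_bigr do rewrite (treated _ t1 D1) mul1r.
Qed.

(** No unit of a staying group is truly treated at [t.-1], so only hidden treatment at [t]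
    contaminates the control trend. *)
Lemma stayer_trend g : stays0 p g t w ->
  (N g t)%:R * (Ybar p g t w - Ybar p g t.-1 w) =
  (N g t)%:R * Y0trend p g t w
  + \sum_(i < N g t) (true_treat i w)%:R * unit_effect i w.
Proof.
move=> /andP[/eqP D1 /eqP D0]; rewrite Ytrend_decomp ?size_gt0//.
rewrite [X in _ - X]big1 ?subr0// => i _.
by rewrite (untreated _ tT (conj D1 D0)) mulr0 mul0r.
Qed.

(* The trends may be centered at any common value m: the weights of the joining
   and of the staying groups cancel by [N10_ratio]. *)
Lemma N10_DID_t_decomp (m : R) : N10 p t w * DID_t p t w =
  \sum_(g | increases p g t w) \sum_(i < N g t) unit_effect i w
  - \sum_(g | joins p g t w) \sum_(i < N g t.-1)
      (N g t)%:R / (N g t.-1)%:R * (true_treat i w)%:R * unit_effect i w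
  - \sum_(g | stays0 p g t w) \sum_(i < N g t)
      N10 p t w / N00 p t w * (true_treat i w)%:R * unit_effect i w
  + \sum_g (N g t)%:R *
      ((joins p g t w)%:R - N10 p t w / N00 p t w * (stays0 p g t w)%:R)
      * (Y0trend p g t w - m).
Proof.
rewrite N10_DID_t (eq_bigr _ joiner_trend) [in LHS](eq_bigr _ stayer_trend).
rewrite !big_split/= sumrN.
rewrite (eq_bigl (fun g => joins p g t w) _ increases_joins).
rewrite [X in _ - X + _](_ : _ = N10 p t w / N00 p t w *
    \sum_(g | stays0 p g t w) \sum_(i < N g t) (true_treat i w)%:R * unit_effect i w).
  set r := N10 p t w / N00 p t w.
  (* Expanding the weights isolates the effect of centering as [m] times [N10 - r * N00], which
     [N10_ratio] makes zero. *)
  have -> : \sum_g (N g t)%:R * ((joins p g t w)%:R - r * (stays0 p g t w)%:R)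
      * (Y0trend p g t w - m) =
    \sum_(g | joins p g t w) (N g t)%:R * Y0trend p g t w
    - r * \sum_(g | stays0 p g t w) (N g t)%:R * Y0trend p g t w
    - m * (N10 p t w - r * N00 p t w).
    (* Every filtered sum becomes a sum over all groups, so the identity is checked for each group
       according to its two indicators. *)
    rewrite /N10 /N00 [\sum_(g | joins _ _ _ _) _ * _]big_mkcond/=.
    rewrite [\sum_(g | joins _ _ _ _) _]big_mkcond/=.
    rewrite [\sum_(g | stays0 _ _ _ _) _ * _]big_mkcond/=.
    rewrite [\sum_(g | stays0 _ _ _ _) _]big_mkcond/=.
    rewrite !mulr_sumr -!sumrB mulr_sumr -sumrB; apply: eq_bigr => g _.
    by case: (joins p g t w); case: (stays0 p g t w); rewrite /=; ring.
  by rewrite N10_ratio subrr; ring.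
rewrite mulr_sumr; apply: eq_bigr => g _; rewrite mulr_sumr.
by apply: eq_bigr => i _; rewrite mulrA.
Qed.

End Period.

(** The weights cancel within each period, so the centering constant may vary with [t], as the
    common trend does. *)
Lemma DID_decomp (m : nat -> R) : DID p T w =
  (N_S p T w)^-1 * (\sum_(2 <= t < T.+1)
    \sum_(g | increases p g t w) \sum_(i < N g t) unit_effect i w)
  - (N_S p T w)^-1 * (\sum_(2 <= t < T.+1)
    \sum_(g | joins p g t w) \sum_(i < N g t.-1)
      (N g t)%:R / (N g t.-1)%:R * (true_treat i w)%:R * unit_effect i w)
  - (N_S p T w)^-1 * (\sum_(2 <= t < T.+1)
    \sum_(g | stays0 p g t w) \sum_(i < N g t)
      N10 p t w / N00 p t w * (true_treat i w)%:R * unit_effect i w)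
  + \sum_(2 <= t < T.+1) \sum_g DID_weight g t w * (Y0trend p g t w - m t).
Proof.
rewrite (_ : \sum_(2 <= t < T.+1) \sum_g _ = (N_S p T w)^-1 *
  \sum_(2 <= t < T.+1) \sum_g (N g t)%:R *
      ((joins p g t w)%:R - N10 p t w / N00 p t w * (stays0 p g t w)%:R)
      * (Y0trend p g t w - m t)).
  rewrite -!mulrBr -mulrDr -!sumrB -big_split/=; congr (_ * _).
  rewrite !big_nat; apply: eq_bigr => t tT; exact: N10_DID_t_decomp.
rewrite mulr_sumr; apply: eq_bigr => t _; rewrite mulr_sumr.
by apply: eq_bigr => g _; rewrite mulrA.
Qed.

End Pointwise.
End Decomposition.

(** * Integrability of the estimator and of the bias terms *)

Section PanelIntegrability.
Context {d} {Omega : measurableType d} {R : realType} (P : probability Omega R).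
Context {G : nat} (p : panel P G) (T : nat).

Local Notation N := (cell_size p).
Local Notation integrable X := (P.-integrable setT (EFin \o X)).

Context (integrable_pot0 : forall g t (i : 'I_(N g t)),
  (1 <= t <= T)%N -> integrable (pot0 i)).
Context (integrable_pot1 : forall g t (i : 'I_(N g t)),
  (1 <= t <= T)%N -> integrable (pot1 i)).

Lemma integrable_unit_effect g t (i : 'I_(N g t)) :
  (1 <= t <= T)%N -> integrable (unit_effect i).
Proof.
by move=> tT; apply: integrable_subr; [exact: integrable_pot1|exact: integrable_pot0].
Qed.

Lemma integrable_treated_effect g t (i : 'I_(N g t)) : (1 <= t <= T)%N ->
  integrable (fun w => (true_treat i w)%:R * unit_effect i w).
Proof.
(* The true status need not be a function of the observed treatments, so it is finitary for
   [measurable] rather than for [sigma_D]. *)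
move=> tT; apply: integrable_finitary_mul; first exact: finitary_true_treat.
exact: integrable_unit_effect.
Qed.

Lemma integrable_Y0bar g t : (1 <= t <= T)%N -> integrable (Y0bar p g t).
Proof.
move=> tT; apply: integrable_mulrl; apply: integrable_sumr => i _ _.
exact: integrable_pot0.
Qed.

Lemma integrable_Ybar g t : (1 <= t <= T)%N -> integrable (Ybar p g t).
Proof.
move=> tT; rewrite (_ : Ybar p g t = fun w => Y0bar p g t w + (N g t)%:R^-1 *
    \sum_(i < N g t) (true_treat i w)%:R * unit_effect i w); last first.
  by apply/funext => w; exact: Ybar_decomp.
apply: integrable_addr; first exact: integrable_Y0bar.
apply: integrable_mulrl; apply: integrable_sumr => i _ _.
exact: integrable_treated_effect.
Qed.

Local Notation FD_sigma := (sigma_D_sigma_algebra p T).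
Local Notation FDm := (@sub_sigma_D_measurable _ _ _ _ _ p T).

Lemma finitary_inv_N_S : finitary measurable (fun w => (N_S p T w)^-1).
Proof. by apply: finitary_comp; apply: sub_finitary FDm _; exact: finitary_N_S. Qed.

(** Measurability for [sigma_D] itself is what makes the weights orthogonal to the centered
    trends. *)
Lemma finitary_DID_weight g t : (2 <= t <= T)%N ->
  finitary (sigma_D p T) (DID_weight p T g t).
Proof.
move=> tT; apply: (finitary_comp2 FD_sigma (fun x y => x^-1 * y)).
  exact: finitary_N_S.
apply: (finitary_comp (fun x => (N g t)%:R * x)).
apply: (finitary_comp2 FD_sigma (fun x y => x - y)).
  by apply: (finitary_comp (fun b : bool => b%:R)); exact: finitary_joins.
apply: (finitary_comp2 FD_sigma (fun x (b : bool) => x * b%:R)).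
  exact: finitary_ratio.
exact: finitary_stays0.
Qed.

Lemma integrable_DID_t t : (2 <= t <= T)%N -> integrable (DID_t p t).
Proof.
move=> tT; have [t1 t1'] := leq_pred2 tT.
(* An existential over groups is a finite disjunction, hence an instance of [finitary_big]. *)
have fin_exists (Q : 'I_G -> Omega -> bool) : (forall g, finitary (sigma_D p T) (Q g)) ->
    finitary (sigma_D p T) (fun w => [exists g, Q g w]).
  move=> fQ; rewrite (_ : (fun w => _) = fun w => \big[orb/false]_g Q g w).
    apply: (finitary_big FD_sigma) => g _; last exact: fQ.
    exact: (finitary_cst FD_sigma true).
  by apply/funext => w; rewrite big_orE.
have iY g : integrable (fun w => (N g t)%:R * (Ybar p g t w - Ybar p g t.-1 w)).
  by apply/integrable_mulrl/integrable_subr; exact: integrable_Ybar.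
(* The case distinction is turned into multiplication by the indicator of its test. *)
rewrite (_ : DID_t p t = fun w =>
  ([exists g, joins p g t w] && [exists g, stays0 p g t w])%:R *
    ((N10 p t w)^-1 *
      (\sum_(g | joins p g t w) (N g t)%:R * (Ybar p g t w - Ybar p g t.-1 w))
    - (N00 p t w)^-1 *
      (\sum_(g | stays0 p g t w) (N g t)%:R * (Ybar p g t w - Ybar p g t.-1 w))));
  last first.
  by apply/funext => w; rewrite /DID_t; case: ifP; rewrite ?mul1r ?mul0r.
apply: integrable_finitary_mul.
  apply: sub_finitary FDm _; apply: (finitary_comp (fun b : bool => b%:R)).
  apply: (finitary_comp2 FD_sigma andb); apply: fin_exists => g.
    exact: finitary_joins.
  exact: finitary_stays0.
apply: integrable_subr; apply: integrable_finitary_mul.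
- by apply: finitary_comp; apply: sub_finitary FDm _; exact: finitary_N10.
- apply: integrable_finitary_sum => // g _.
  by apply: sub_finitary FDm _; exact: finitary_joins.
- by apply: finitary_comp; apply: sub_finitary FDm _; exact: finitary_N00.
- apply: integrable_finitary_sum => // g _.
  by apply: sub_finitary FDm _; exact: finitary_stays0.
Qed.

(** The random factor [N_S^-1] takes finitely many values, so it preserves integrability. *)
Lemma integrable_period_average (X : nat -> Omega -> R) :
  (forall t, (2 <= t <= T)%N -> integrable (X t)) ->
  integrable (fun w => (N_S p T w)^-1 * \sum_(2 <= t < T.+1) X t w).
Proof.
move=> iX; apply: integrable_finitary_mul; first exact: finitary_inv_N_S.
by apply: integrable_sumr => t; rewrite mem_index_iota => /iX.
Qed.

Lemma integrable_DID : integrable (DID p T).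
Proof.
apply: integrable_period_average => t tT; apply: integrable_finitary_mul.
  by apply: sub_finitary FDm _; exact: finitary_N10.
exact: integrable_DID_t.
Qed.

Lemma integrable_switcher_effects : integrable (fun w => (N_S p T w)^-1 *
  \sum_(2 <= t < T.+1) \sum_(g | increases p g t w)
    \sum_(i < N g t) unit_effect i w).
Proof.
apply: integrable_period_average => t tT; have [t1 _] := leq_pred2 tT.
apply: integrable_finitary_sum => g _.
  by apply: sub_finitary FDm _; exact: finitary_increases.
by apply: integrable_sumr => i _ _; exact: integrable_unit_effect.
Qed.

Lemma integrable_joiner_bias : integrable (fun w => (N_S p T w)^-1 *
  \sum_(2 <= t < T.+1) \sum_(g | joins p g t w) \sum_(i < N g t.-1)
    (N g t)%:R / (N g t.-1)%:R * (true_treat i w)%:R * unit_effect i w).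
Proof.
apply: integrable_period_average => t tT; have [_ t1'] := leq_pred2 tT.
apply: integrable_finitary_sum => g _.
  by apply: sub_finitary FDm _; exact: finitary_joins.
apply: integrable_sumr => i _ _.
under eq_fun do rewrite -mulrA.
exact/integrable_mulrl/integrable_treated_effect.
Qed.

Lemma integrable_stayer_bias : integrable (fun w => (N_S p T w)^-1 *
  \sum_(2 <= t < T.+1) \sum_(g | stays0 p g t w) \sum_(i < N g t)
    N10 p t w / N00 p t w * (true_treat i w)%:R * unit_effect i w).
Proof.
apply: integrable_period_average => t tT; have [t1 _] := leq_pred2 tT.
apply: integrable_finitary_sum => g _.
  by apply: sub_finitary FDm _; exact: finitary_stays0.
apply: integrable_sumr => i _ _.
under eq_fun do rewrite -mulrA.
apply: integrable_finitary_mul; last exact: integrable_treated_effect.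
by apply: sub_finitary FDm _; exact: finitary_ratio.
Qed.

Lemma integrable_weighted_trend (m : R) g t : (2 <= t <= T)%N ->
  integrable (fun w => DID_weight p T g t w * (Y0trend p g t w - m)).
Proof.
move=> tT; have [t1 t1'] := leq_pred2 tT.
apply: integrable_finitary_mul.
  by apply: sub_finitary FDm _; exact: finitary_DID_weight.
apply: integrable_subr; first by apply: integrable_subr; exact: integrable_Y0bar.
exact: finite_measure_integrable_cst.
Qed.

End PanelIntegrability.

(** * Expectation of the estimator *)

Theorem proposition3 (d : measure_display) (Omega : measurableType d)
    (R : realType) (P : probability Omega R) (G T : nat) (p : panel P G)
    (integrable_pot0 : forall (g : 'I_G) (t : nat) (i : 'I_(cell_size p g t)),
      (1 <= t <= T)%N -> P.-integrable setT (EFin \o pot0 i))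
    (integrable_pot1 : forall (g : 'I_G) (t : nat) (i : 'I_(cell_size p g t)),
      (1 <= t <= T)%N -> P.-integrable setT (EFin \o pot1 i))
    (balanced_panel : forall (g : 'I_G) (t : nat),
      (1 <= t <= T)%N -> (0 < cell_size p g t)%N)
    (sharp_design : forall (g : 'I_G) (t : nat) (i : 'I_(cell_size p g t)),
      (1 <= t <= T)%N ->
      {ae P, forall w, (obs_treat i w)%:R = Dbar p g t w})
    (mean_independence : forall (g : 'I_G) (t : nat),
      (2 <= t <= T)%N ->
      cond_expectation_eq P (sigma_D p T) (sigma_Dg p T g) (Y0bar p g t))
    (* The same at t = 1, without which the conclusion can fail. *)
    (mean_independence_period1 : forall g : 'I_G,
      (2 <= T)%N ->
      cond_expectation_eq P (sigma_D p T) (sigma_Dg p T g) (Y0bar p g 1))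
    (strong_exogeneity : forall (g : 'I_G) (t : nat),
      (2 <= t <= T)%N ->
      mean_indep P (sigma_Dg p T g) (Y0trend p g t))
    (parallel_trends : forall (g k : 'I_G) (t : nat),
      (2 <= t <= T)%N ->
      ('E_P[Y0trend p g t] = 'E_P[Y0trend p k t])%E)
    (staggered_adoption : forall (g : 'I_G) (t : nat),
      (2 <= t <= T)%N ->
      {ae P, forall w, Dbar p g t.-1 w <= Dbar p g t w})
    (misclassification_treated :
      forall (g : 'I_G) (t : nat) (i : 'I_(cell_size p g t)),
      (1 <= t <= T)%N ->
      cond_prob_eq1 P [set w | true_treat i w = true]
                      [set w | Dbar p g t w = 1])
    (misclassification_untreated :
      forall (g : 'I_G) (t : nat) (j : 'I_(cell_size p g t.-1)),
      (2 <= t <= T)%N ->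
      cond_prob_eq1 P [set w | true_treat j w = false]
                      [set w | Dbar p g t w = 0 /\ Dbar p g t.-1 w = 0])
    (comparison_groups : forall (g : 'I_G) (t : nat),
      (2 <= t <= T)%N ->
      {ae P, forall w, Dbar p g t.-1 w = 0 -> Dbar p g t w = 1 ->
        exists g' : 'I_G,
          [/\ g' != g, Dbar p g' t.-1 w = 0 & Dbar p g' t w = 0]}) :
  ('E_P[DID p T] =
    delta_S p T
    - 'E_P[(fun w => (N_S p T w)^-1 *
        \sum_(2 <= t < T.+1) \sum_(g | joins p g t w)
          \sum_(i < cell_size p g t.-1)
            (cell_size p g t)%:R / (cell_size p g t.-1)%:R
            * (true_treat i w)%:R * unit_effect i w)%R]
    - 'E_P[(fun w => (N_S p T w)^-1 *
        \sum_(2 <= t < T.+1) \sum_(g | stays0 p g t w)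
          \sum_(i < cell_size p g t)
            N10 p t w / N00 p t w
            * (true_treat i w)%:R * unit_effect i w)%R])%E.
Proof.
(* The common mean trend of period [t], read off an arbitrary group; by parallel trends the choice
   does not matter. The default 0 serves only [G = 0]. *)
pose m t : R := if [pick g : 'I_G] is Some g then fine 'E_P[Y0trend p g t] else 0.
have mE g t : (2 <= t <= T)%N -> m t = fine 'E_P[Y0trend p g t].
  move=> tT; rewrite /m; case: pickP => [k _|/(_ g)//].
  by rewrite (parallel_trends k g t tT).
have iY0 := integrable_Y0bar integrable_pot0.
(* A trend at [t = 2] contains the level of period 1, so the two mean independence hypotheses are
   merged to cover both levels of every trend. *)
have mean_indep_all g t : (1 <= t <= T)%N -> (2 <= T)%N ->
    cond_expectation_eq P (sigma_D p T) (sigma_Dg p T g) (Y0bar p g t).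
  case: t => [|[|t]]// tT T2; first exact: mean_independence_period1.
  exact: mean_independence.
have trend0 g t : (2 <= t <= T)%N ->
    (\int[P]_w (DID_weight p T g t w * (Y0trend p g t w - m t))%:E = 0)%E.
  move=> tT; have [t1 t1'] := leq_pred2 tT.
  have T2 : (2 <= T)%N by case/andP: tT => /leq_trans; apply.
  have iYt : P.-integrable setT (EFin \o Y0trend p g t).
    by apply: integrable_subr; exact: iY0.
  apply: (integral_finitary_mul_eq0 (@sub_sigma_D_measurable _ _ _ _ _ p T)).
  - exact: finitary_DID_weight.
  - by apply: integrable_subr => //; exact: finite_measure_integrable_cst.
  move=> A DA; rewrite (mE g t tT).
  apply: (integral_centered_eq0 (@sub_sigma_D_measurable _ _ _ _ _ p T)
    (@sub_sigma_Dg_measurable _ _ _ _ _ p T g)) DA.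
  - exact: iY0.
  - exact: iY0.
  - exact: mean_indep_all.
  - exact: mean_indep_all.
  - exact: strong_exogeneity.
have mD g t c : measurable [set w | Dbar p g t w = c].
  rewrite (_ : mkset _ = Dbar p g t @^-1` [set c])//.
  by rewrite -[_ @^-1` _]setTI; exact: measurable_Dbar.
have mtreat g t (i : 'I_(cell_size p g t)) b :
    measurable [set w | true_treat i w = b].
  rewrite (_ : mkset _ = true_treat i @^-1` [set b])//.
  by rewrite -[_ @^-1` _]setTI; exact: (measurable_funP (true_treat i)).
have D01 : {ae P, forall w, forall t g, (1 <= t <= T)%N ->
    Dbar p g t w = 0 \/ Dbar p g t w = 1}.
  (* The null sets are collected over countably many periods and finitely many groups; periods out
     of range impose nothing. *)
  apply: ae_foralln => t; apply: filter_forall => g.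
  have [tT|_] := boolP (1 <= t <= T)%N; last exact: filterE.
  (* A nonempty cell supplies a unit, and its binary observed status equals [Dbar] by the sharp
     design. *)
  have i : 'I_(cell_size p g t) := Ordinal (balanced_panel g t tT).
  by apply: filterS (sharp_design g t i tT) => w <- _; case: (obs_treat i w); auto.
have treated : {ae P, forall w, forall t g (i : 'I_(cell_size p g t)),
    (1 <= t <= T)%N -> Dbar p g t w = 1 -> true_treat i w = true}.
  apply: ae_foralln => t; apply: filter_forall => g; apply: filter_forall => i.
  have [tT|_] := boolP (1 <= t <= T)%N; last exact: filterE.
  have := cond_prob_eq1_ae (mtreat g t i true) (mD g t 1)
    (misclassification_treated g t i tT).
  by apply: filterS => w + _.
have untreated : {ae P, forall w, forall t g (i : 'I_(cell_size p g t.-1)),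
    (2 <= t <= T)%N -> Dbar p g t w = 0 /\ Dbar p g t.-1 w = 0 ->
    true_treat i w = false}.
  apply: ae_foralln => t; apply: filter_forall => g; apply: filter_forall => i.
  have [tT|_] := boolP (2 <= t <= T)%N; last exact: filterE.
  have := cond_prob_eq1_ae (mtreat g t.-1 i false)
    (measurableI _ _ (mD g t 0) (mD g t.-1 0))
    (misclassification_untreated g t i tT).
  by apply: filterS => w + _.
have comparison : {ae P, forall w, forall t g, (2 <= t <= T)%N ->
    Dbar p g t.-1 w = 0 -> Dbar p g t w = 1 ->
    exists g', [/\ g' != g, Dbar p g' t.-1 w = 0 & Dbar p g' t w = 0]}.
  apply: ae_foralln => t; apply: filter_forall => g.
  have [tT|_] := boolP (2 <= t <= T)%N; last exact: filterE.
  by apply: filterS (comparison_groups g t tT) => w + _.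
have iS := integrable_switcher_effects integrable_pot0 integrable_pot1.
have iJ := integrable_joiner_bias integrable_pot0 integrable_pot1.
have i0 := integrable_stayer_bias integrable_pot0 integrable_pot1.
have iDID := integrable_DID integrable_pot0 integrable_pot1.
have iW g t := integrable_weighted_trend integrable_pot0 (m t) g (t := t).
have iSW : P.-integrable setT (EFin \o (fun w => \sum_(2 <= t < T.+1)
    \sum_g DID_weight p T g t w * (Y0trend p g t w - m t))).
  apply: integrable_sumr => t; rewrite mem_index_iota => tT _.
  by apply: integrable_sumr => g _ _; exact: iW.
have SW0 : (\int[P]_w (\sum_(2 <= t < T.+1)
    \sum_g DID_weight p T g t w * (Y0trend p g t w - m t))%:E = 0)%E.
  apply: integral_sumr_eq0 => t; rewrite mem_index_iota => tT.
    by apply: integrable_sumr => g _ _; exact: iW.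
  by apply: integral_sumr_eq0 => g _; [exact: iW|exact: trend0].
rewrite /delta_S unlock -!integral_subr//; last exact: integrable_subr.
(* The weighted centered trends have zero integral and are added to the right-hand side, after which
   the two integrands agree almost surely by [DID_decomp]. *)
rewrite -[RHS]adde0 -[X in (_ + X)%E]SW0 -integralD_EFin//; last first.
  by apply: integrable_subr => //; exact: integrable_subr.
have iR := integrable_addr (integrable_subr (integrable_subr iS iJ) i0) iSW.
apply: ae_eq_integral => //.
- exact: measurable_int iDID.
- exact: measurable_int iR.
apply: filterS3 D01 treated (filterI untreated comparison).
move=> w Dw tw [uw cw] _; by congr EFin; apply: DID_decomp => //; auto.
Qed.
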